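(* For every ordinal $\kappa$, the space $C_p(\kappa)$ is an Ascoli space.
   Context: Every ordinal $\kappa$ is identified with the set of all smaller ordinals and carries the order topology generated by its natural well-order (subbase: the sets $\{z\in\kappa : z<x\}$ and $\{z\in\kappa : z>x\}$, $x\in\kappa$). For a Tychonoff space $X$, $C(X)$ is the set of all continuous real-valued functions on $X$; $C_p(X)$ denotes $C(X)$ with the topology of pointwise convergence, and $C_k(X)$ denotes $C(X)$ with the compact-open topology. A subset $\mathcal{K}\subseteq C_k(Y)$ is evenly continuous if the evaluation map $Y\times\mathcal{K}\to\mathbb{R}$, $(y,f)\mapsto f(y)$, is continuous, where $\mathcal{K}$ carries the topology induced from $C_k(Y)$. A Tychonoff space $Y$ is called an Ascoli space if every compact subset $\mathcal{K}$ of $C_k(Y)$ is evenly continuous (equivalently, the natural evaluation map $Y\to C_k(C_k(Y))$ is a topological embedding). *)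

(* Defs.v *)
From HB Require Import structures.
From mathcomp Require Import all_boot all_order all_algebra.
From mathcomp Require Import all_classical all_reals topology normedtype.

Set Implicit Arguments.
Unset Strict Implicit.
Unset Printing Implicit Defensive.

Import Order.TTheory GRing.Theory Num.Theory.
Import numFieldNormedType.Exports.

Local Open Scope classical_set_scope.

(* [continuousType X R] carries no canonical topology; the two aliases below
   give it the subspace topologies inherited from the pointwise, resp.
   compact-open, topology on all functions [X -> R]. *)
Definition Cp (R : realType) (X : topologicalType) : Type :=
  continuousType X R.

HB.instance Definition _ (R : realType) (X : topologicalType) :=
  Topological.copy (Cp R X)
    (initial_topology (fun f : continuousType X R => (f : {ptws X -> R}))).

Definition Ck (R : realType) (X : topologicalType) : Type :=
  continuousType X R.

HB.instance Definition _ (R : realType) (X : topologicalType) :=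
  Topological.copy (Ck R X)
    (initial_topology
      (fun f : continuousType X R => (f : {compact-open, X -> R}))).

(* [completely_regular_space] is the library's uniform formulation of the
   separation of points and closed sets by real functions, see
   [uniform_separatorP]. *)
Definition tychonoff_space (X : topologicalType) : Prop :=
  hausdorff_space X /\ completely_regular_space X.

Definition ck_eval (R : realType) (Y : topologicalType) (K : set (Ck R Y))
    (yf : Y * set_type K) : R :=
  (\val yf.2 : continuousType Y R) yf.1.

(* [set_type K] has the topology induced from [Ck R Y]. *)
Definition evenly_continuous (R : realType) (Y : topologicalType)
    (K : set (Ck R Y)) : Prop :=
  continuous (@ck_eval R Y K).

Definition ascoli_space (R : realType) (Y : topologicalType) : Prop :=
  tychonoff_space Y /\
  forall K : set (Ck R Y), compact K -> evenly_continuous K.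

(* Main.v *)
Require Import Defs.
From mathcomp Require Import all_boot all_order all_algebra.
From mathcomp Require Import all_classical all_reals topology normedtype.
From mathcomp Require Import interval_inference wochoice.

(** Even continuity of a compact [K] in [C_k(C_p(kappa))] amounts to its
    equicontinuity at each [f].  Two facts about [K] and [C_p(kappa)] clash when
    equicontinuity fails.

    On the one hand, a compact [K] in [C_k(Y)] is always equicontinuous along a
    convergent sequence [u n --> y], because [{y} + range u] is compact and
    hence tested by the compact-open topology
    ([compact_Ck_seq_equicontinuous]).

    On the other hand, suppose that arbitrarily close to [f] there are [g] on
    which some [phi] in [K] moves by at least [e].  Being continuous at [g] for
    the pointwise topology, [phi] hardly sees [g] outside a finite set [G].
    Initial segments of an ordinal are clopen, so [g] may be replaced by [f]
    above [G] without losing continuity, and [phi] still moves by [e / 2].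
    Hence [f] is in the closure of a set of functions each of which agrees with
    [f] off an initial segment generated by finitely many points.  The space
    [C_p(kappa)] need not be Frechet-Urysohn (when [kappa] has uncountable
    cofinality, it is not), but for sets of this kind a sequence does the job
    ([closure_Cp_sequence]).  It is produced by a bookkeeping argument: the
    finite set on which the next function must be close to [f] collects, for
    all previous functions, a bound of the place where they differ from [f],
    and the left end points of intervals on which they are close to [f].  Well-
    foundedness turns closeness on these countably many points into pointwise
    convergence on all of [kappa]. *)

Set Implicit Arguments.
Unset Strict Implicit.
Unset Printing Implicit Defensive.

Import Order.TTheory GRing.Theory Num.Theory.
Import numFieldNormedType.Exports.

Local Open Scope classical_set_scope.
Local Open Scope ring_scope.

(** * Spaces of continuous functions with the pointwise topology *)

Section Cp_topology.
Variables (R : realType) (X : topologicalType).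
Implicit Types (f g : Cp R X) (L : seq X).

Lemma Cp_completely_regular : completely_regular_space (Cp R X).
Proof.
exact: (@uniform_completely_regular R
  (initial_topology (fun f : continuousType X R => (f : {ptws X -> R})))).
Qed.

Lemma Cp_cvgP (F : set_system (Cp R X)) (FF : Filter F) f :
  F --> f <-> forall x, (fun g : Cp R X => g x) @ F --> f x.
Proof.
pose i := fun f : continuousType X R => (f : {ptws X -> R}).
split=> [Ff x|Ff].
  have : {ptws, i @ F --> (f : X -> R)}.
    exact: (cvg_trans (cvg_app i Ff) (@initial_continuous _ _ i f)).
  by move/pointwise_cvgP => /(_ x).
have iF : {ptws, i @ F --> (f : X -> R)} by apply/pointwise_cvgP.
move=> U [V [[W oW <-] /= Wf WU]].
rewrite nbhs_filterE; apply: (filterS WU).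
by apply: iF; exact: open_nbhs_nbhs.
Qed.

Lemma eval_Cp_continuous x : continuous (fun g : Cp R X => g x).
Proof.
move=> f; have [+ _] := Cp_cvgP (nbhs_filter f) f.
by move=> /(_ (@cvg_id _ (nbhs f))) /(_ x).
Qed.

Lemma Cp_hausdorff : hausdorff_space (Cp R X).
Proof.
move=> f g fg; apply/continuousEP => x.
apply: (@norm_hausdorff R R^o) => A B Af Bg.
have [h [hA hB]] := fg _ _ (eval_Cp_continuous Af) (eval_Cp_continuous Bg).
by exists (h x).
Qed.

Lemma nbhs_Cp_finite f L (e : R) : 0 < e ->
  nbhs f [set g : Cp R X | forall x, x \in L -> `|g x - f x| < e].
Proof.
move=> e0; elim: L => [|s L IH].
  by rewrite (_ : [set _ | _] = setT); [exact: filterT|exact/seteqP].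
have ns : \forall g \near f, `|(g : Cp R X) s - f s| < e.
  by have /cvgr_distC_lt := @eval_Cp_continuous s f; exact.
apply: filterS2 ns IH => g gs gL t; rewrite inE => /orP[/eqP ->//|].
exact: gL.
Qed.

(** The sets of [nbhs_Cp_finite] generate a filter that converges to [f] at
    every point, hence in [C_p(X)]. *)
Lemma Cp_nbhs_finite f (U : set (Cp R X)) : nbhs f U ->
  exists L (e : R), 0 < e /\
    forall g, (forall x, x \in L -> `|g x - f x| < e) -> U g.
Proof.
pose D := [set p : seq X * R | 0 < p.2].
pose B (p : seq X * R) :=
  [set g : Cp R X | forall x, x \in p.1 -> `|g x - f x| < p.2].
have FB : Filter (filter_from D B).
  apply: filter_from_filter; first by exists ([::], 1); exact: ltr01.
  move=> [L e] [M d] /= e0 d0; exists (L ++ M, Num.min e d).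
    by rewrite /D /= lt_min e0.
  move=> g /= gLM; split=> x xLM.
    have /gLM : x \in L ++ M by rewrite mem_cat xLM.
    by rewrite lt_min => /andP[].
  have /gLM : x \in L ++ M by rewrite mem_cat xLM orbT.
  by rewrite lt_min => /andP[].
have: filter_from D B --> f.
  apply/Cp_cvgP => x; apply/cvgrPdist_lt => e e0.
  by exists ([:: x], e) => // g /= /(_ x (mem_head _ _)); rewrite distrC.
by move=> /[apply] -[[L e] e0 LeU]; exists L, e.
Qed.

End Cp_topology.

(** * Compact sets in the compact-open topology *)

Lemma compact_range_cvg (Y : topologicalType) (u : nat -> Y) (l : Y) :
  u @ \oo --> l -> compact ([set l] `|` range u).
Proof.
move=> ul F PF FC.
have [Fl|nFl] := pselect (cluster F l); first by exists l; split => //; left.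
have [A [U [FA lU AU]]] :
    exists A U, [/\ F A, nbhs l U & forall z, A z -> ~ U z].
  apply: contrapT => noAU; apply: nFl => A U FA lU; apply: contrapT => AU0.
  by apply: noAU; exists A, U; split => // z Az Uz; apply: AU0; exists z.
have [N _ uN] := ul _ lU.
(* F avoids a neighborhood of l, so it lives on finitely many terms of u *)
have Ffin : F (u @` `I_N).
  apply: filterS (filterI FC FA) => y [[->|[n _ <-]] Ay].
    by case: (AU l) => //; exact: nbhs_singleton.
  exists n => //=; rewrite ltnNge; apply/negP => Nn.
  by case: (AU (u n)) => //; exact: uN.
have cfin : compact (u @` `I_N).
  by apply: finite_compact; apply: finite_image; exact: finite_II.
have [p [[n _ <-] cp]] := cfin F PF Ffin.
by exists (u n); split => //; right; exists n.
Qed.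

Section compact_Ck.
Variables (R : realType) (Y : topologicalType).

(** Let [psi] in [K] be a cluster point of [phi].  A tail of [u], together with
    [y], is a compact set that [psi] maps into a small ball, and mapping this
    compact set into that ball is an open condition in [C_k(Y)]: it is met by
    some [phi n] with [n] in the tail. *)
Lemma compact_Ck_seq_equicontinuous (K : set (Ck R Y)) (u : nat -> Y) (y : Y)
    (phi : nat -> Ck R Y) (e : R) :
  compact K -> u @ \oo --> y -> (forall n, K (phi n)) -> 0 < e ->
  exists n, `|phi n (u n) - phi n y| < e.
Proof.
move=> cK uy Kphi e0.
have [|psi [Kpsi psi_cl]] := cK (phi @ \oo) _.
  by exists 0%N => // n _; exact: Kphi.
have e20 : 0 < e / 2 by rewrite divr_gt0.
pose O := ball (psi y) (e / 2).
have [N _ uO] := uy _ (@cts_fun Y R psi y _ (nbhsx_ballx _ _ e20)).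
pose C := [set y] `|` range (fun n => u (n + N)%N).
have cC : compact C.
  apply: compact_range_cvg.
  have := cvg_comp _ _ (cvg_addnr N) uy.
  exact.
pose W := [set g : Ck R Y | (g : Y -> R) @` C `<=` O].
have nW : nbhs psi W.
  apply: open_nbhs_nbhs; split; last first.
    move=> _ [z [->|[n _ <-]] <-]; first exact: ballxx.
    by apply: uO; rewrite /= leq_addl.
  exists [set g : {compact-open, Y -> R} | g @` C `<=` O] => //.
  by apply: compact_open_open => //; exact: ball_open.
have phiN : (phi @ \oo) (phi @` [set n | (N <= n)%N]).
  by exists N => // n Nn; exists n.
have [_ [[n /= Nn <-] Wn]] := psi_cl _ _ phiN nW.
have Oy : O (phi n y) by apply: Wn; exists y => //; left.
have Ou : O (phi n (u n)).
  by apply: Wn; exists (u n) => //; right; exists (n - N)%N => //; rewrite subnK.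
by exists n; exact: ball_splitr Ou Oy.
Qed.

Lemma equicontinuous_evenly_continuous (K : set (Ck R Y)) :
  (forall (y : Y) (e : R), 0 < e ->
     \forall z \near y, forall phi, K phi -> `|phi z - phi y| < e) ->
  evenly_continuous K.
Proof.
move=> eqK -[y phi]; apply/cvgrPdist_lt => e e0.
have e20 : 0 < e / 2 by rewrite divr_gt0.
pose O := ball ((\val phi : Ck R Y) y) (e / 2).
pose V := [set g : Ck R Y | O (g y)].
have nV : nbhs phi (\val @^-1` V : set (set_type K)).
  apply: initial_continuous; apply: open_nbhs_nbhs; split; last exact: ballxx.
  (* evaluation at y is continuous on C_k(Y) since {y} is compact *)
  exists [set g : {compact-open, Y -> R} | g @` [set y] `<=` O].
    by apply: compact_open_open; [exact: compact_set1 | exact: ball_open].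
  apply/seteqP; split => g /=; first by apply; exists y.
  by move=> ? _ [_ -> <-].
exists ([set z | forall psi, K psi -> `|psi z - psi y| < e / 2], \val @^-1` V).
  by split => //=; exact: eqK.
move=> [z psi] /= [zy psiV].
apply: (@ball_split _ _ ((\val psi : Ck R Y) y)); first exact: psiV.
by rewrite /ball /= distrC; apply: zy; exact: set_valP.
Qed.

End compact_Ck.

(** * Well-ordered spaces *)

Section well_ordered_space.
Variables (R : realType) (d : Order.disp_t) (X : orderTopologicalType d).
Hypothesis X_wo : well_order (<=%O : rel X).
Implicit Types (x s t : X) (L M : seq X) (f g : Cp R X).

Lemma wo_least (P : X -> Prop) : (exists x, P x) ->
  exists m, P m /\ forall x, P x -> (m <= x)%O.
Proof.
move=> [x Px].
have [|m [[/asboolP Pm mP] _]] := X_wo (A := [pred x | `[< P x >]]).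
  by exists x; apply/asboolP.
by exists m; split => // y Py; apply: mP; apply/asboolP.
Qed.

(** Finite lists stand for bounds, rather than single points, so that the
    empty initial segment is covered and [X] may be empty. *)
Definition below L x : bool := has (fun s => (x <= s)%O) L.

(** Initial segments are clopen: [x <= s] is a closed condition, and an open one
    since it says [x < t] for [t] the successor of [s], if there is one. *)
Lemma near_below L x : \forall y \near x, below L y = below L x.
Proof.
suff ray s : \forall y \near x, (y <= s)%O = (x <= s)%O.
  elim: L => [|s L IH]; first by apply: nearW.
  by apply: filterS2 (ray s) IH => y ys yL; congr (_ || _).
have [xs|sx] := leP x s; last first.
  have : nbhs x (`]s, +oo[%classic : set X).
    by apply: open_nbhs_nbhs; split; [exact: rray_open|rewrite /= in_itv /= sx].
  by apply: filterS => y /=; rewrite in_itv /= andbT => /lt_geF.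
have [ex|nex] := pselect (exists t, (s < t)%O); last first.
  by apply: nearW => y; rewrite leNgt; apply/negP => sy; apply: nex; exists y.
have [t [st tmin]] := wo_least ex.
have : nbhs x (`]-oo, t[%classic : set X).
  apply: open_nbhs_nbhs; split; first exact: lray_open.
  by rewrite /= in_itv /= (le_lt_trans xs st).
apply: filterS => y /=; rewrite in_itv /= => yt.
by rewrite leNgt; apply/negP => /tmin; rewrite leNgt yt.
Qed.

Lemma graft_continuous f g L :
  continuous (fun x => if below L x then g x else f x).
Proof.
move=> x; rewrite /continuous_at.
case: ifPn => [bx|/negbTE bx].
  apply: cvg_trans _ (@cts_fun X R g x); apply: near_eq_cvg.
  by apply: filterS (near_below L x) => y; rewrite bx => ->.
apply: cvg_trans _ (@cts_fun X R f x); apply: near_eq_cvg.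
by apply: filterS (near_below L x) => y; rewrite bx => ->.
Qed.

Definition graft f g L : Cp R X := mkcts (@graft_continuous f g L).

Lemma graftE f g L x : graft f g L x = if below L x then g x else f x.
Proof. by []. Qed.

Lemma nbhs_left s (V : set X) : nbhs s V ->
  exists M, forall x, (x <= s)%O ->
    (forall t, t \in M -> (t < s)%O -> (t < x)%O) -> V x.
Proof.
rewrite itv_nbhsE => -[[a b] /= [oab sab] abV].
case: a oab sab abV => [[] t|[]] oab; rewrite itv_boundlr => /andP[sa sb] abV.
- by move: oab; case: b sb abV => [[] ?|[]].
- exists [:: t] => x xs xM; apply: abV; rewrite /= itv_boundlr.
  rewrite (le_trans _ sb) ?bnd_simp// andbT.
  by apply: xM; rewrite ?mem_head.
- exists [::] => x xs _; apply: abV; rewrite /= itv_boundlr.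
  by rewrite (le_trans _ sb) ?bnd_simp.
- by move: sa.
Qed.

(** The list [M] gathers a left end point for each [s] in [L]; its members that
    are not less than [s] serve other points of [L]. *)
Lemma nbhs_left_seq L (V : set X) : (forall s, s \in L -> nbhs s V) ->
  exists M, forall s, s \in L -> forall x, (x <= s)%O ->
    (forall t, t \in M -> (t < s)%O -> (t < x)%O) -> V x.
Proof.
elim: L => [|s L IH] LV; first by exists [::].
have [M1 M1V] := nbhs_left (LV s (mem_head _ _)).
have [t tL|M2 M2V] := IH; first by apply: LV; rewrite inE tL orbT.
exists (M1 ++ M2) => r; rewrite inE => /orP[/eqP ->|rL] x xr xM.
  by apply: M1V => // t tM; apply: xM; rewrite mem_cat tM.
by apply: M2V rL _ xr _ => t tM; apply: xM; rewrite mem_cat tM orbT.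
Qed.

(** Finite sets [S n] and functions [u n] are chosen in turn: [u n] is
    [1 / (n + 1)]-close to [f] on [S n], and [S n.+1] adds to [S n] a bound
    above which [u n] is [f] and, for each [s] in [S n], a point [t < s] such
    that [u n] stays close to [f] on [(t, s]], unless [u n] is close to [f] on
    the whole segment up to [s].  Now fix [x].  If no point of the
    union [S] of the [S n] is above [x], then [u n x = f x] for all [n].
    Otherwise let [s] be the least point of [S] with [x <= s]: as soon as [s]
    is in [S n], the left end point [t] chosen for it, if any, is in [S] and
    less than [s], hence less than [x], so that [u n] is close to [f] at [x]. *)
Lemma closure_Cp_sequence (A : set (Cp R X)) f :
  closure A f ->
  (forall g, A g -> exists M, forall x, ~~ below M x -> g x = f x) ->
  exists u : nat -> Cp R X, (forall n, A (u n)) /\ u @ \oo --> f.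
Proof.
move=> Af bA.
pose close n g : set X := [set x | `|g x - f x| < n.+1%:R^-1].
have step n L : exists gM : Cp R X * seq X,
    [/\ A gM.1, {subset L <= gM.2},
        forall x, ~~ below gM.2 x -> gM.1 x = f x &
        forall s, s \in L -> forall x, (x <= s)%O ->
          (forall t, t \in gM.2 -> (t < s)%O -> (t < x)%O) -> close n gM.1 x].
  have n0 : 0 < n.+1%:R^-1 :> R by rewrite invr_gt0.
  have [g [Ag gL]] := Af _ (nbhs_Cp_finite f L n0).
  have [M0 gM0] := bA _ Ag.
  have [s sL|M1 gM1] := @nbhs_left_seq L (close n g).
    have gf : (fun x => `|g x - f x|) @ s --> `|g s - f s|.
      apply: cvg_norm; apply: cvgB; first exact: (@cts_fun X R g).
      exact: (@cts_fun X R f).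
    by move: gf => /cvgr_lt; apply; exact: gL.
  exists (g, L ++ M0 ++ M1); split => //=.
  - by move=> s sL; rewrite mem_cat sL.
  - by move=> x; rewrite /below !has_cat !negb_or => /and3P[_ + _]; exact: gM0.
  - move=> s sL x xs xM; apply: gM1 sL _ xs _ => t tM; apply: xM.
    by rewrite !mem_cat tM !orbT.
have [st stP] := choice (fun nL : nat * seq X => step nL.1 nL.2).
pose S := fix S n := if n is n'.+1 then (st (n', S n')).2 else [::].
pose u n := (st (n, S n)).1.
have subS m n : (m <= n)%N -> {subset S m <= S n}.
  move=> /subnK <-; elim: (n - m)%N => [|k IH] // s /IH.
  by rewrite addSn /=; have [_ + _ _] := stP ((k + m)%N, S (k + m)%N); exact.
exists u; split => [n|]; first by have [] := stP (n, S n).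
apply/Cp_cvgP => x.
have [ex|nex] := pselect (exists s, (exists n, s \in S n) /\ (x <= s)%O);
    last first.
  apply: cvg_near_cst; exists 0%N => // n _ /=.
  have [_ _ + _] := stP (n, S n); apply; apply/hasPn => s sM.
  by apply/negP => xs; apply: nex; exists s; split => //; exists n.+1.
have [s [[[N sN] xs] smin]] := wo_least ex.
apply/cvgrPdist_lt => e e0.
suff : \forall n \near \oo, `|f x - u n x| < e by [].
near=> n.
have Nn : (N <= n)%N by near: n; exact: nbhs_infty_ge.
have [_ _ _ clo] := stP (n, S n).
have unx : close n (u n) x.
  apply: clo (subS _ _ Nn _ sN) _ xs _ => t tM ts.
  rewrite ltNge; apply/negP => xt.
  by have := smin t (conj (ex_intro _ n.+1 tM) xt); rewrite leNgt ts.
rewrite distrC; apply: (lt_trans unx).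
by near: n; exact: (near_infty_natSinv_lt (PosNum e0)).
Unshelve. all: by end_near. Qed.

Lemma compact_Ck_Cp_equicontinuous (K : set (Ck R (Cp R X))) f (e : R) :
  compact K -> 0 < e ->
  \forall g \near f, forall phi, K phi -> `|phi g - phi f| < e.
Proof.
move=> cK e0; apply: contrapT => nK.
have e20 : 0 < e / 2 by rewrite divr_gt0.
pose A := [set g : Cp R X | (exists M, forall x, ~~ below M x -> g x = f x) /\
  exists phi : Ck R (Cp R X), K phi /\ e / 2 <= `|phi g - phi f|].
have Af : closure A f.
  move=> U /Cp_nbhs_finite[L [a [a0 LU]]].
  have [g [gL [phi [Kphi phig]]]] : exists g,
      (forall x, x \in L -> `|g x - f x| < a) /\
      exists phi : Ck R (Cp R X), K phi /\ e <= `|phi g - phi f|.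
    apply: contrapT => nog; apply: nK.
    apply: filterS (nbhs_Cp_finite f L a0) => g gL phi Kphi.
    rewrite ltNge; apply/negP => phig; apply: nog; exists g; split => //.
    by exists phi.
  have /cvgr_distC_lt/(_ _ e20)/Cp_nbhs_finite[G [b [b0 Gb]]] :=
    @cts_fun (Cp R X) R phi g.
  (* h is g up to the finite sets L and G, and f above them *)
  pose h := graft f g (L ++ G).
  have hg : `|phi h - phi g| < e / 2.
    apply: Gb => x xG; rewrite graftE.
    rewrite (_ : below _ x) ?subrr ?normr0//.
    by apply/hasP; exists x; rewrite ?lexx// mem_cat xG orbT.
  exists h; split; last first.
    apply: LU => x xL; rewrite graftE.
    by case: ifP => // _; [exact: gL | rewrite subrr normr0].
  split; first by exists (L ++ G) => x /negbTE xLG; rewrite graftE xLG.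
  exists phi; split => //; rewrite leNgt; apply/negP => hf.
  move: phig; rewrite leNgt => /negP; apply.
  exact: (@ball_splitr _ _ (phi h) _ _ _ hg hf).
have [u [Au uf]] := closure_Cp_sequence Af (fun g Ag => Ag.1).
have [phi phiP] := choice (fun n => (Au n).2).
have [n] := compact_Ck_seq_equicontinuous cK uf (fun n => (phiP n).1) e20.
by rewrite ltNge (phiP n).2.
Qed.

End well_ordered_space.

Theorem theorem1p1 (R : realType) (d : Order.disp_t) (kappa : orderType d)
    (kappa_wo : well_order (<=%O : rel kappa)) :
  ascoli_space R (Cp R (order_topology kappa)).
Proof.
split; first by split; [exact: Cp_hausdorff|exact: Cp_completely_regular].
move=> K cK; apply: equicontinuous_evenly_continuous => f e e0.
exact: compact_Ck_Cp_equicontinuous.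
Qed.
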